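(* Let $I=\int_{[0,1]^{d_1}}f\left(\int_{[0,1]^{d_2}}g(\boldsymbol y,\boldsymbol x)\,\mathrm d\boldsymbol x\right)\mathrm d\boldsymbol y$, and assume that $|f''|$ and $|f'''|$ are monotonic and that the following hold. (1) There exist $0<b<\infty$ and $A_i>0$, $1\le i\le d_1$, $\max_iA_i<1/2$, such that $\tilde f=f(\bar g_h)$ satisfies $$\left|\frac{\partial^{|u|}\tilde f}{\prod_{j\in u}\partial z_j}(\boldsymbol z)\right|\le b\prod_{i=1}^{d_1}\min(z_i,1-z_i)^{-A_i-\mathbf 1\{i\in u\}}$$ for all $\boldsymbol z\in(0,1)^{d_1}$ and all $u\subseteq\{1,\dots,d_1\}$. (2) $\left|\int_{[0,1]^{d_1}}f(\bar g_h(\boldsymbol y))\,\mathrm d\boldsymbol y-I\right|\le C_{\mathrm{disc}}h^{\eta}$ with $\eta>0$ and $C_{\mathrm{disc}}>0$ independent of $h$, and the work of evaluating $g_h$ is $\mathcal O(h^{-\gamma})$ for some $\gamma>0$. (3) There exist $0<\delta_K<1$ and $1\le p\le\infty$ such that $f(K\bar g_h(\cdot))\in W^{3,p}([0,1]^{d_1})$ for all $K\in(1-\delta_K,1+\delta_K)$. (4) There exists $0\le k<\infty$ such that $\sup_{\boldsymbol y\in[0,1]^{d_1}}\left|V_{\mathrm{HK}}(g_h(\boldsymbol y,\cdot))/\bar g_h(\boldsymbol y)\right|\le k$ as $h\to0$, and $\bar g_h\in L^{3q}([0,1]^{d_1})$ for some $1\le q\le\infty$ with $1/p+1/q=1$,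 $p$ as in (3). (5) There exist $0<\delta_K'<1$ and $1\le p'\le\infty$ such that, as $h\to0$, $f(K\bar g_h(\cdot))\in W^{2,2p'}([0,1]^{d_1})$ for all $K\in(1-\delta_K',1+\delta_K')$. (6) The bound on $V_{\mathrm{HK}}(g_h(\boldsymbol y,\cdot))/\bar g_h(\boldsymbol y)$ in (4) holds, and $\bar g_h\in L^{4q'}([0,1]^{d_1})$ for some $1\le q'\le\infty$ with $1/p'+1/q'=1$, $p'$ as in (5). Then the total work of the optimized rDLQMC estimator (see context) for a specified error tolerance $TOL>0$ is $$W_{\mathrm{rDLQ}}^{*}=\mathcal O\left(TOL^{-\left(\frac{2}{2-2\epsilon-2\max_iA_i}+\frac{1}{2-2\epsilon}+\frac{\gamma}{\eta}\right)}\right)\qquad\text{as }TOL\to0,$$ for any (sufficiently small) $\epsilon>0$, where the constant implied by the $\mathcal O$ notation approaches infinity as $\epsilon\to0$.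
   Context: Here $d_1,d_2$ are positive integers, $f:\mathbb R\to\mathbb R$ is nonlinear, $g:[0,1]^{d_1}\times[0,1]^{d_2}\to\mathbb R$, and for a discretization parameter $h>0$, $g_h$ is an approximation of $g$ on the same domain, with $\bar g_h(\boldsymbol y)=\int_{[0,1]^{d_2}}g_h(\boldsymbol y,\boldsymbol x)\,\mathrm d\boldsymbol x$. The relevant moments of $\bar g_h$ and of its compositions with derivatives of $f$ are assumed to stay finite as $h\to0$. rDLQMC estimator. Let $\boldsymbol u^{(1)},\dots,\boldsymbol u^{(N)}\in[0,1]^{d_1}$ and $\boldsymbol t^{(1)},\dots,\boldsymbol t^{(M)}\in[0,1]^{d_2}$ be the first points of (base 2) digital low-discrepancy sequences, and let $\boldsymbol\rho,\boldsymbol\rho^{(1)},\dots,\boldsymbol\rho^{(N)}$ be independent randomizations by Owen's scrambling (random nested permutation of base 2 digits, the same for all points of a given sequence). With $\boldsymbol y^{(n)}=\boldsymbol\rho(\boldsymbol u^{(n)})$, $\boldsymbol x^{(n,m)}=\boldsymbol\rho^{(n)}(\boldsymbol t^{(m)})$, $$I_{\mathrm{rDLQ}}=\frac1N\sum_{n=1}^Nf\left(\frac1M\sum_{m=1}^Mg_h(\boldsymbol y^{(n)},\boldsymbol x^{(n,m)})\right).$$ Its computational work is $W_{\mathrm{rDLQ}}=\mathcal O(NMh^{-\gamma})$. Optimized estimator. The error criterion is that $|\mathbb E[I_{\mathrm{rDLQ}}]-I|\le(1-\kappa)TOL$ and $C_\alpha\sqrt{\mathbb V[I_{\mathrm{rDLQ}}]}\le\kappa\,TOL$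 for an error-splitting parameter $\kappa\in(0,1)$, where $\alpha\in(0,1)$ is fixed and $C_\alpha=1/\sqrt\alpha$; by Chebyshev this gives $|I_{\mathrm{rDLQ}}-I|\le TOL$ with probability at least $1-\alpha$. Neglecting higher-order terms, the bias and variance bounds are $C_{\mathrm{disc}}h^\eta+C^{(3)}_{\mathrm Q,\epsilon}M^{-(2-2\epsilon)}$ and $C^{(1)}_{\mathrm Q,\epsilon}N^{-(2-2\epsilon-2\max_iA_i)}+C^{(2)}_{\mathrm Q,\epsilon}N^{-1}M^{-(2-2\epsilon)}$, where $C^{(1)}_{\mathrm Q,\epsilon}=2b^2B_A^2C_{\epsilon,d_1}^2$, $C^{(2)}_{\mathrm Q,\epsilon}=2\mathbb E[|\bar g_h|^2|f'(\bar g_h)|^2]k^2C_{\epsilon,d_2}^2$ and $C^{(3)}_{\mathrm Q,\epsilon}=\frac12\mathbb E[|\bar g_h|^2|f''(\bar g_h)|]k^2C_{\epsilon,d_2}^2$ are treated as constants (independent of $N,M,h,TOL$), and tend to $\infty$ as $\epsilon\to0$. Here $C_{\epsilon,d}$ is a constant, independent of the number $M$ of points, bounding the star discrepancy of the scrambled points in dimension $d$ by $C_{\epsilon,d}M^{-1+\epsilon}$, and $B_A$ is a constant depending on the $A_i$ such that the root mean square error of averaging $\tilde f$ over $N$ scrambled points is at most $bB_AC_{\epsilon,d_1}N^{-1+\epsilon+\max_iA_i}$. The optimized rDLQMC estimator uses $(N^*,M^*,h^*,\kappa^* )$ solving $$\min_{(N,M,h,\kappa)}NMh^{-\gamma}\quad\text{subject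 to}\quad\frac{C^{(1)}_{\mathrm Q,\epsilon}}{N^{2-2\epsilon-2\max_iA_i}}+\frac{C^{(2)}_{\mathrm Q,\epsilon}}{NM^{2-2\epsilon}}\le\left(\frac{\kappa\,TOL}{C_\alpha}\right)^2,\qquad C_{\mathrm{disc}}h^\eta+\frac{C^{(3)}_{\mathrm Q,\epsilon}}{M^{2-2\epsilon}}\le(1-\kappa)TOL,$$ and $W^*_{\mathrm{rDLQ}}$ is its work, i.e. the minimal value of $NMh^{-\gamma}$ up to a multiplicative constant. Hardy--Krause variation. For $\varphi:[0,1]^d\to\mathbb R$ with continuous mixed first-order derivatives, recursively $V_{\mathrm{HK}}(\varphi)=\int_{[0,1]^d}\left|\frac{\partial^d\varphi}{\partial z_1\cdots\partial z_d}(\boldsymbol z)\right|\mathrm d\boldsymbol z+\sum_{i=1}^dV_{\mathrm{HK}}(\varphi|_{z_i=1})$, and for $d=1$, $V_{\mathrm{HK}}(\varphi)=\int_0^1|\varphi'(z)|\,\mathrm dz$. *)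

(* Defs.v *)
From HB Require Import structures.
From mathcomp Require Import all_boot all_order all_algebra all_fingroup.
From mathcomp Require Import all_classical all_reals all_analysis.

Set Implicit Arguments.
Unset Strict Implicit.
Unset Printing Implicit Defensive.

Import Order.TTheory GRing.Theory Num.Theory.
Import numFieldNormedType.Exports.

Local Open Scope classical_set_scope.
Local Open Scope ring_scope.

(* Points of R^d are row vectors, which carry the topology and the directional
   derivatives; functions on [0,1]^d are total functions on R^d of which only
   the values on the cube are used. *)
Definition cube (R : realType) d : set 'rV[R]_d :=
  [set z | forall i, 0 <= z 0 i <= 1].

Definition open_cube (R : realType) d : set 'rV[R]_d :=
  [set z | forall i, 0 < z 0 i < 1].

Section cube_measure.
Context (R : realType).
Local Notation RT := (measurableTypeR R).

Definition tcons d (p : RT * d.-tuple RT) : d.+1.-tuple RT :=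
  [the d.+1.-tuple RT of p.1 :: p.2].

Lemma measurable_tcons d : measurable_fun setT (@tcons d).
Proof. by apply: measurable_cons; [exact: measurable_fst|exact: measurable_snd]. Qed.

HB.instance Definition _ d :=
  isMeasurableFun.Build _ _ _ _ (@tcons d) (@measurable_tcons d).

(* Lebesgue measure on [0,1]^d, as the d-fold product of the uniform
   probability on [0,1]; the library puts a sigma-algebra on tuples but not on
   row vectors, so it lives on tuples, and [vec] transports them. *)
Fixpoint cube_prob d : probability (d.-tuple RT) R :=
  match d with
  | 0 => dirac ([tuple] : 0.-tuple RT)
  | d'.+1 => distribution (uniform_prob (@ltr01 R) \x cube_prob d')%E (@tcons d')
  end.

Definition vec d (t : d.-tuple RT) : 'rV[R]_d := \row_i tnth t i.

Definition tcube d : set (d.-tuple RT) := @vec d @^-1` @cube R d.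

Definition cube_int d (F : 'rV[R]_d -> R) : R :=
  \int[cube_prob d]_(t in @tcube d) F (vec t).

Definition cube_inte d (F : 'rV[R]_d -> \bar R) : \bar R :=
  (\int[cube_prob d]_(t in @tcube d) F (vec t))%E.

Definition cube_integrable d (F : 'rV[R]_d -> R) : Prop :=
  (cube_prob d).-integrable (@tcube d) (fun t => (F (vec t))%:E).

(* The complement of the cube is null for [cube_prob d]. *)
Definition cube_Lp d (p : \bar R) (F : 'rV[R]_d -> R) : Prop :=
  measurable_fun (@tcube d) (F \o @vec d) /\
  finite_norm (cube_prob d) p (F \o @vec d).

End cube_measure.

Section differential.
Context (R : realType).

Definition pderiv d (i : 'I_d) (F : 'rV[R]_d -> R) : 'rV[R]_d -> R :=
  fun z => 'D_(delta_mx 0 i) F z.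

Definition iter_pderiv d (s : seq 'I_d) (F : 'rV[R]_d -> R) : 'rV[R]_d -> R :=
  foldr (@pderiv d) F s.

(* [D u] is the mixed first-order derivative of [F] with respect to the
   coordinates in [u], on the set [S]. On the closed cube a partial derivative
   is only asked for where the differentiated coordinate is interior, which
   involves the values of [F] on the cube only; the end points are reached by
   continuity in [mixed_C1]. *)
Definition mixed_partials d (S : set 'rV[R]_d) (F : 'rV[R]_d -> R)
    (D : {set 'I_d} -> 'rV[R]_d -> R) : Prop :=
  (forall z, S z -> D finset.set0 z = F z) /\
  (forall (u : {set 'I_d}) (i : 'I_d) (z : 'rV[R]_d),
    i \notin u -> S z -> 0 < z 0 i < 1 ->
    is_derive z (delta_mx 0 i : 'rV[R]_d) (D u) (D (i |: u)%SET z)).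

Definition mixed_C1 d (F : 'rV[R]_d -> R) : Prop :=
  exists2 D, mixed_partials (@cube R d) F D &
    forall u, {within @cube R d, continuous (D u)}.

Definition set_coord1 d (i : 'I_d.+1) (z : 'rV[R]_d) : 'rV[R]_d.+1 :=
  \row_j (if unlift i j is Some k then z 0 k else 1).

(* Hardy--Krause variation. Starting the recursion at 0 in dimension 0 gives
   the integral of |F'| in dimension 1. *)
Fixpoint VHK d : ('rV[R]_d -> R) -> \bar R :=
  match d with
  | 0 => fun _ => 0%E
  | d'.+1 => fun F =>
      (cube_inte (fun z => `|iter_pderiv (enum 'I_d'.+1) F z|%:E) +
       \sum_(i < d'.+1) VHK (F \o set_coord1 i))%E
  end.

Definition test_function d (phi : 'rV[R]_d -> R) : Prop :=
  [/\ forall s, continuous (iter_pderiv s phi),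
      forall s i z, derivable (iter_pderiv s phi) z (delta_mx 0 i : 'rV[R]_d),
      compact (closure [set z | phi z != 0]) &
      closure [set z | phi z != 0] `<=` @open_cube R d].

Definition weak_partial d (s : seq 'I_d) (F v : 'rV[R]_d -> R) : Prop :=
  forall phi, test_function phi ->
    cube_int (fun z => F z * iter_pderiv s phi z) =
    (-1) ^+ size s * cube_int (fun z => v z * phi z).

(* W^{k,p}([0,1]^d); multi-indices are given as lists of directions. *)
Definition sobolev d (k : nat) (p : \bar R) (F : 'rV[R]_d -> R) : Prop :=
  cube_Lp p F /\
  forall s : seq 'I_d, (size s <= k)%N ->
    exists2 v, cube_Lp p v & weak_partial s F v.

Definition nonlinear (f : R -> R) : Prop :=
  ~ exists a c : R, forall x, f x = a * x + c.

Definition monotonic (F : R -> R) : Prop :=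
  {homo F : x y / x <= y} \/ {homo F : x y /~ x <= y}.

End differential.

Section scrambled_sequences.
Context (R : realType).

(* A point of [0,1]^d is handled through its binary digits: [a j k] is the
   digit of weight 2^-(k+1) of coordinate j. *)
Definition bits_point d (a : 'I_d -> nat -> bool) : 'rV[R]_d :=
  \row_j limn (series (fun k => (a j k)%:R / 2 ^+ k.+1 : R)).

(* Digits of the n-th point (n >= 0) of the base 2 digital sequence with
   generating matrices [G j] over F_2; the binary digits of n of rank >= n
   vanish. *)
Definition digital_sequence d (G : 'I_d -> nat -> nat -> bool) (n : nat) :
    'I_d -> nat -> bool :=
  fun j k => \big[addb/false]_(r < n) (G j k r && odd (n %/ 2 ^ r)).

Definition star_discrepancy d (x : nat -> 'rV[R]_d) (N : nat) : R :=
  sup [set `|(\sum_(n < N) [forall i, x n 0 i < z 0 i]%:R) / N%:R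
             - \prod_i z 0 i| | z in @cube R d].

Definition low_discrepancy d (x : nat -> 'rV[R]_d) : Prop :=
  exists c : R, forall N, (2 <= N)%N ->
    star_discrepancy x N <= c * ln N%:R ^+ d / N%:R.

(* Nested permutation of the digits: the permutation applied to a digit of
   coordinate j is indexed by the (unscrambled) digits preceding it. *)
Definition scramble d (pi : 'I_d -> seq bool -> {perm bool})
    (a : 'I_d -> nat -> bool) : 'I_d -> nat -> bool :=
  fun j k => pi j (mkseq (a j) k) (a j k).

Context (dO : measure_display) (Omega : measurableType dO)
  (P : probability Omega R).

Definition iid_uniform (I : eqType) (T : finType) (X : I -> Omega -> T) : Prop :=
  (forall i c, measurable (X i @^-1` [set c])) /\
  (forall (s : seq I) (c : I -> T), uniq s ->
    P (\bigcap_(i in [set` s]) (X i @^-1` [set c i])) =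
    ((#|T|%:R^-1) ^+ size s)%:E).

(* [rho] and [rhos 0], [rhos 1], ... are independent Owen scramblings, i.e.
   all their elementary permutations are independent and uniform. *)
Definition owen_scramblings d1 d2
    (rho : 'I_d1 -> seq bool -> Omega -> {perm bool})
    (rhos : nat -> 'I_d2 -> seq bool -> Omega -> {perm bool}) : Prop :=
  iid_uniform
    (fun i : ('I_d1 * seq bool) + (nat * ('I_d2 * seq bool)) =>
       match i with
       | inl (j, w) => rho j w
       | inr (n, (j, w)) => rhos n j w
       end).

Definition scrambled_point d (rho : 'I_d -> seq bool -> Omega -> {perm bool})
    (G : 'I_d -> nat -> nat -> bool) (w : Omega) (n : nat) : 'rV[R]_d :=
  bits_point (scramble (fun j s => rho j s w) (digital_sequence G n)).

End scrambled_sequences.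

Section rDLQMC.
Context (R : realType) (d1 d2 : nat).

Definition nested_integral (f : R -> R) (g : 'rV[R]_d1 -> 'rV[R]_d2 -> R) : R :=
  cube_int (fun y => f (cube_int (g y))).

Definition gbar (g : 'rV[R]_d1 -> 'rV[R]_d2 -> R) : 'rV[R]_d1 -> R :=
  fun y => cube_int (g y).

Definition Amax (A : 'I_d1 -> R) : R := \big[Num.max/0]_i A i.

Context (dO : measure_display) (Omega : measurableType dO).

Definition rDLQ (f : R -> R) (gh : R -> 'rV[R]_d1 -> 'rV[R]_d2 -> R)
    (Gu : 'I_d1 -> nat -> nat -> bool) (Gt : 'I_d2 -> nat -> nat -> bool)
    (rho : 'I_d1 -> seq bool -> Omega -> {perm bool})
    (rhos : nat -> 'I_d2 -> seq bool -> Omega -> {perm bool})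
    (N M : nat) (h : R) (w : Omega) : R :=
  N%:R^-1 * \sum_(n < N) f (M%:R^-1 * \sum_(m < M)
    gh h (scrambled_point R rho Gu w n) (scrambled_point R (rhos n) Gt w m)).

(* The estimator evaluates g_h exactly N M times. *)
Definition rDLQ_work (cost : R -> R) (N M : nat) (h : R) : R :=
  N%:R * M%:R * cost h.

Definition CQ1 (b BA Cd : R) : R := 2 * b ^+ 2 * BA ^+ 2 * Cd ^+ 2.

(* [m2] and [m3] bound, uniformly in h, the moments E[|gbar|^2 |f'(gbar)|^2]
   and E[|gbar|^2 |f''(gbar)|]. *)
Definition CQ2 (m2 k Cd : R) : R := 2 * m2 * k ^+ 2 * Cd ^+ 2.

Definition CQ3 (m3 k Cd : R) : R := 2^-1 * m3 * k ^+ 2 * Cd ^+ 2.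

Definition Calpha (alpha : R) : R := (Num.sqrt alpha)^-1.

Definition variance_bound (C1 C2 eps a : R) (N M : nat) : R :=
  C1 / N%:R `^ (2 - 2 * eps - 2 * a) + C2 / (N%:R * M%:R `^ (2 - 2 * eps)).

Definition bias_bound (Cdisc eta C3 eps : R) (M : nat) (h : R) : R :=
  Cdisc * h `^ eta + C3 / M%:R `^ (2 - 2 * eps).

Definition rDLQ_feasible (C1 C2 C3 Cdisc eta alpha a eps TOL : R)
    (N M : nat) (h kappa : R) : Prop :=
  [/\ (0 < N)%N /\ (0 < M)%N, 0 < h, 0 < kappa < 1,
      variance_bound C1 C2 eps a N M <= (kappa * TOL / Calpha alpha) ^+ 2 &
      bias_bound Cdisc eta C3 eps M h <= (1 - kappa) * TOL].

Definition rDLQ_optimal (C1 C2 C3 Cdisc eta gamma alpha a eps TOL : R)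
    (N M : nat) (h kappa : R) : Prop :=
  rDLQ_feasible C1 C2 C3 Cdisc eta alpha a eps TOL N M h kappa /\
  forall N' M' h' kappa',
    rDLQ_feasible C1 C2 C3 Cdisc eta alpha a eps TOL N' M' h' kappa' ->
    rDLQ_work (fun x => x `^ (- gamma)) N M h <=
    rDLQ_work (fun x => x `^ (- gamma)) N' M' h'.

(* [Ihat] is an optimized estimator and [W] its work, for parameters
   constrained by [opt]. *)
Definition optimized_rDLQ (opt : nat -> nat -> R -> R -> Prop)
    (f : R -> R) (gh : R -> 'rV[R]_d1 -> 'rV[R]_d2 -> R)
    (Gu : 'I_d1 -> nat -> nat -> bool) (Gt : 'I_d2 -> nat -> nat -> bool)
    (rho : 'I_d1 -> seq bool -> Omega -> {perm bool})
    (rhos : nat -> 'I_d2 -> seq bool -> Omega -> {perm bool})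
    (cost : R -> R) (Ihat : Omega -> R) (W : R) : Prop :=
  exists N M h kappa,
    [/\ opt N M h kappa, Ihat = rDLQ f gh Gu Gt rho rhos N M h &
        W = rDLQ_work cost N M h].

Definition work_exponent (a eta gamma eps : R) : R :=
  2 / (2 - 2 * eps - 2 * a) + (2 - 2 * eps)^-1 + gamma / eta.

End rDLQMC.

(* Main.v *)
Require Import Defs.
From mathcomp Require Import all_boot all_order all_algebra all_fingroup.
From mathcomp Require Import all_classical all_reals all_analysis.
From mathcomp Require Import ring lra.

Import Order.TTheory GRing.Theory Num.Theory.
Import numFieldNormedType.Exports.

Local Open Scope classical_set_scope.
Local Open Scope ring_scope.

(** The assertion concerns the size of the minimum of [N M h^-gamma] under the
    two error constraints.  Write [beta = 2 - 2 eps - 2 max A] and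
    [delta = 2 - 2 eps], so that the exponent of the work is
    [2 / beta + 1 / delta + gamma / eta].

    Each summand of the exponent is the price of one error term.  Whatever
    [kappa] is, the first variance term is at most [alpha TOL^2], the inner
    sampling bias is at most [TOL] and so is the discretization bias; this
    forces [N] to be at least of order [TOL^(-2/beta)], [M] of order
    [TOL^(-1/delta)] and [h^-1] of order [TOL^(-1/eta)]
    ([feasible_work_ge]).  Conversely, choosing the three parameters of exactly
    these orders, with [kappa = 1/2] and large enough factors, is feasible
    ([feasible_cheap]).  The remaining variance term [C2 / (N M^delta)] is then
    of order [TOL^(2/beta + 1)], which is dominated by [TOL^2] because
    [beta <= 2].  Comparing an optimum with this choice gives the order of the
    work.

    An optimum exists ([optimal_exists]): for given [N] and [M] the smallest
    admissible [kappa] leaves the most room for the bias, hence gives the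
    largest admissible [h]; and since [h] is bounded above, the work dominates
    a multiple of [N M], so that only finitely many pairs compete.

    Finally, the lower bound also shows that any implied constant for
    [N M h^-gamma] is at least
    [(C1/alpha)^(1/beta) C3^(1/delta) Cdisc^(gamma/eta)].  The exponent
    [1/beta] is at least [1/2], so this blows up with [C1] and [C3] as [eps]
    tends to 0. *)

(** * Real powers and coercive minimization *)

Section power_laws.
Context {R : realType}.
Implicit Types c r s T x : R.

Lemma powRV_le {r x y : R} : 0 < r -> 0 <= x -> 0 <= y ->
  (x `^ r^-1 <= y) = (x <= y `^ r).
Proof.
move=> r0 x0 y0; have rn0 : r != 0 by rewrite gt_eqF.
apply/idP/idP => H.
  have := @ge0_ler_powR _ r (ltW r0) (x `^ r^-1) y.
  rewrite !nnegrE powR_ge0 y0 => /(_ erefl erefl H).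
  by rewrite -powRrM mulVf // powRr1.
have rV0 : 0 <= r^-1 by rewrite invr_ge0 ltW.
have := @ge0_ler_powR _ r^-1 rV0 x (y `^ r).
rewrite !nnegrE powR_ge0 x0 => /(_ erefl erefl H).
by rewrite -powRrM mulfV // powRr1.
Qed.

(** Solves for [x] a constraint [c T^-s <= x^r]; each of the error constraints
    has this form in the number of samples or in the inverse step. *)
Lemma powR_root_le {c T s r x} : 0 < r -> 0 <= c -> 0 <= x ->
  c * T `^ (- s) <= x `^ r -> c `^ r^-1 * T `^ (- (s / r)) <= x.
Proof.
move=> r0 c0 x0 le_cx.
by rewrite -mulNr powRrM -powRM ?powR_ge0 // powRV_le // mulr_ge0 ?powR_ge0.
Qed.

Lemma powRVN {x} r : 0 <= x -> x^-1 `^ r = x `^ (- r).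
Proof. by move=> x0; rewrite -powR_inv1 // -powRrM mulN1r. Qed.

Lemma powRN2 T : 0 < T -> T `^ (- 2) = T ^- 2.
Proof. by move=> T0; rewrite powR_invn // ltW. Qed.

(** Rounding up a sample size costs at most 1, which for [T <= 1] is absorbed
    by the power of [T]. *)
Lemma nat_near_power {c T s} : 0 < c -> 0 < T <= 1 -> 0 <= s ->
  exists2 n, (0 < n)%N & c * T `^ (- s) <= n%:R <= (c + 1) * T `^ (- s).
Proof.
move=> c0 /andP[T0 T1] s0.
have X0 : 0 <= c * T `^ (- s) by rewrite mulr_ge0 ?powR_ge0 // ltW.
have T_ge1 : 1 <= T `^ (- s).
  by rewrite -(powRr0 T) ger_powR ?T0 // oppr_le0.
exists (Num.truncn (c * T `^ (- s))).+1 => //.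
have /andP[lo hi] := truncn_itv X0.
by rewrite (ltW hi) /= -natr1 mulrDl mul1r lerD.
Qed.

(** Below the value reached at one admissible pair, the bound on [w] leaves only
    finitely many pairs. *)
Lemma coercive_pair_min {Q : nat -> nat -> Prop} {w : nat -> nat -> R} {c} :
  0 < c -> (exists N M, Q N M) ->
  (forall N M, Q N M -> [/\ (0 < N)%N, (0 < M)%N & c * (N%:R * M%:R) <= w N M]) ->
  exists N M, Q N M /\ forall N' M', Q N' M' -> w N M <= w N' M'.
Proof.
move=> c0 [N0 [M0 Q0]] Qw.
pose B := (Num.truncn (w N0 M0 / c)).+1.
have inB N M : Q N M -> w N M <= w N0 M0 -> (N < B)%N /\ (M < B)%N.
  move=> /Qw[N_gt0 M_gt0 cw] ww.
  have NMB : (N * M < B)%N.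
    rewrite ltnS truncn_ge_nat; last first.
      rewrite divr_ge0 // ?(ltW c0) //; have [_ _] := Qw _ _ Q0.
      by apply: le_trans; rewrite mulr_ge0 ?(ltW c0).
    by rewrite natrM ler_pdivlMr // mulrC (le_trans cw).
  by split; apply: leq_ltn_trans NMB; rewrite ?leq_pmulr ?leq_pmull.
have [N0B M0B] := inB _ _ Q0 (lexx _).
pose p0 : 'I_B * 'I_B := (Ordinal N0B, Ordinal M0B).
have Qp0 : `[< Q p0.1 p0.2 >] by exact/asboolP.
case: (arg_minP (fun p : 'I_B * 'I_B => w p.1 p.2)
  (P := fun p : 'I_B * 'I_B => `[< Q p.1 p.2 >]) Qp0) => p /asboolP Qp p_min.
exists p.1, p.2; split=> // N M QNM.
have [ww|/ltW ww] := leP (w N M) (w N0 M0); last first.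
  by apply: le_trans ww; exact: (p_min p0).
have [NB MB] := inB _ _ QNM ww.
by apply: (p_min (Ordinal NB, Ordinal MB)); exact/asboolP.
Qed.

End power_laws.

(** * The constrained minimization of the work *)

Section sample_allocation.
Context {R : realType} {C1 C2 C3 Cdisc eta gamma alpha a eps : R}.
Context (C1_gt0 : 0 < C1) (C2_ge0 : 0 <= C2) (C3_ge0 : 0 <= C3).
Context (Cdisc_gt0 : 0 < Cdisc) (eta_gt0 : 0 < eta) (gamma_gt0 : 0 < gamma).
Context (alpha_gt0 : 0 < alpha).
Context (a_ge0 : 0 <= a) (eps_gt0 : 0 < eps) (eps_lt : eps < 1 - a).

Local Notation beta := (2 - 2 * eps - 2 * a).
Local Notation delta := (2 - 2 * eps).
Local Notation feasible := (rDLQ_feasible C1 C2 C3 Cdisc eta alpha a eps).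
Local Notation optimal := (rDLQ_optimal C1 C2 C3 Cdisc eta gamma alpha a eps).
Local Notation model_work := (rDLQ_work (fun x : R => x `^ (- gamma))).

Let beta_gt0 : 0 < beta. Proof. move: eps_gt0 eps_lt a_ge0; lra. Qed.
Let delta_gt0 : 0 < delta. Proof. move: eps_gt0 eps_lt a_ge0; lra. Qed.

Lemma sqr_tolerance (kappa TOL : R) :
  (kappa * TOL / Calpha alpha) ^+ 2 = alpha * (kappa * TOL) ^+ 2.
Proof.
by rewrite /Calpha invrK exprMn sqr_sqrtr ?(ltW alpha_gt0) // mulrC.
Qed.

Lemma powR_nat_gt0 (n : nat) (r : R) : (0 < n)%N -> 0 < n%:R `^ r :> R.
Proof. by move=> n0; rewrite powR_gt0 // ltr0n. Qed.

Lemma variance_bound_gt0 N M :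
  (0 < N)%N -> (0 < M)%N -> 0 < variance_bound C1 C2 eps a N M.
Proof.
move=> N0 M0; rewrite ltr_wpDr ?divr_ge0 ?mulr_ge0 ?ler0n ?powR_ge0 //.
by rewrite divr_gt0 // powR_nat_gt0.
Qed.

(** Each nonnegative error term is at most the whole budget, and [kappa] and
    [1 - kappa] are less than 1; dropping everything else leaves one necessary
    condition per parameter. *)
Lemma feasible_bounds {TOL N M h kappa} : 0 < TOL -> feasible TOL N M h kappa ->
  [/\ C1 / alpha * TOL `^ (- 2) <= N%:R `^ beta,
      C3 * TOL `^ (- 1) <= M%:R `^ delta &
      Cdisc * TOL `^ (- 1) <= h^-1 `^ eta].
Proof.
move=> T0 [[N0 M0] h0 /andP[k0 k1] + bias].
rewrite sqr_tolerance => var.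
have N_gt0 : 0 < N%:R `^ beta :> R by exact: powR_nat_gt0.
have M_gt0 : 0 < M%:R `^ delta :> R by exact: powR_nat_gt0.
have hp : 0 < h `^ eta by exact: powR_gt0.
have bias_T : bias_bound Cdisc eta C3 eps M h <= TOL.
  by apply: le_trans bias _; rewrite ler_piMl // ?(ltW T0) //; move: k0; lra.
have C3M : 0 <= C3 / M%:R `^ delta by rewrite divr_ge0 // ltW.
have Ch : 0 <= Cdisc * h `^ eta by rewrite mulr_ge0 // ltW.
split.
- rewrite powRN2 // ler_pdivrMr ?exprn_gt0 // ler_pdivrMr //.
  have var1 : C1 / N%:R `^ beta <= alpha * (kappa * TOL) ^+ 2.
    apply: le_trans var; rewrite lerDl.
    by rewrite divr_ge0 // mulr_ge0 ?ler0n ?powR_ge0.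
  have var2 : alpha * (kappa * TOL) ^+ 2 <= alpha * TOL ^+ 2.
    rewrite ler_pM2l // ler_sqr ?nnegrE ?mulr_ge0 ?(ltW T0) ?(ltW k0) //.
    by rewrite ler_piMl ?(ltW k1) ?(ltW T0).
  by move: (le_trans var1 var2); rewrite ler_pdivrMr // => /le_trans; apply; lra.
- rewrite powR_inv1 ?(ltW T0) // ler_pdivrMr //.
  have : C3 / M%:R `^ delta <= TOL.
    by apply: le_trans bias_T; rewrite lerDr.
  by rewrite ler_pdivrMr // mulrC.
- rewrite powR_inv1 ?(ltW T0) // ler_pdivrMr // powRVN ?(ltW h0) // powRN.
  by rewrite mulrC ler_pdivlMr //; apply: le_trans bias_T; rewrite lerDl.
Qed.

Lemma step_work_ge {TOL N M h kappa} : 0 < TOL -> feasible TOL N M h kappa ->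
  Cdisc `^ (gamma / eta) * TOL `^ (- (gamma / eta)) <= h `^ (- gamma).
Proof.
move=> T0 feas; have [_ h0 _ _ _] := feas.
have [_ _] := feasible_bounds T0 feas => Hh.
have hV0 : 0 <= h^-1 by rewrite invr_ge0 ltW.
have := powR_root_le eta_gt0 (ltW Cdisc_gt0) hV0 Hh.
move=> H; have := @ge0_ler_powR _ gamma (ltW gamma_gt0) _ _ _ _ H.
rewrite !nnegrE mulr_ge0 ?powR_ge0 // hV0 => /(_ erefl erefl).
rewrite powRM ?powR_ge0 // -!powRrM (mulrC _ gamma) mul1r mulNr.
by rewrite (mulrC _ gamma) powRVN ?(ltW h0).
Qed.

Lemma feasible_work_ge {TOL N M h kappa} : 0 < TOL -> feasible TOL N M h kappa ->
  (C1 / alpha) `^ beta^-1 * C3 `^ delta^-1 * Cdisc `^ (gamma / eta)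
    * TOL `^ (- work_exponent a eta gamma eps) <= model_work N M h.
Proof.
move=> T0 feas.
have [HN HM _] := feasible_bounds T0 feas.
have C1a : 0 <= C1 / alpha by rewrite divr_ge0 ?ltW.
have {}HN := powR_root_le beta_gt0 C1a (ler0n _ _) HN.
have {}HM := powR_root_le delta_gt0 C3_ge0 (ler0n _ _) HM.
have Hh := step_work_ge T0 feas.
have Tn0 : TOL != 0 by rewrite gt_eqF.
rewrite /work_exponent !opprD !powRD ?Tn0 ?implybT // /rDLQ_work.
rewrite mul1r in HM.
rewrite [leLHS](_ : _ =
    ((C1 / alpha) `^ beta^-1 * TOL `^ (- (2 / beta)))
  * (C3 `^ delta^-1 * TOL `^ (- delta^-1))
  * (Cdisc `^ (gamma / eta) * TOL `^ (- (gamma / eta)))); last by ring.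
by do !(apply: ler_pM => //; rewrite ?mulr_ge0 ?powR_ge0 //).
Qed.

(** Reduces the existence of feasible parameters to tolerances at most 1. *)
Lemma feasible_mono {TOL TOL' N M h kappa} : 0 < TOL <= TOL' ->
  feasible TOL N M h kappa -> feasible TOL' N M h kappa.
Proof.
move=> /andP[T0 TT'] [NM h0 kap var bias]; have /andP[k0 k1] := kap.
have T'0 := lt_le_trans T0 TT'.
split => //.
- apply: le_trans var _; rewrite !sqr_tolerance ler_pM2l //.
  rewrite ler_sqr ?nnegrE ?mulr_ge0 ?(ltW T0) ?(ltW T'0) ?(ltW k0) //.
  by rewrite ler_pM2l.
- by apply: le_trans bias _; rewrite ler_wpM2l // subr_ge0 ltW.
Qed.

(** With [kappa = 1/2], each of the two variance terms is given half of
    [alpha TOL^2 / 4] and each of the two bias terms half of [TOL / 2]. *)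
Lemma feasible_cheap : exists K, forall TOL, 0 < TOL <= 1 ->
  exists N M h kappa, feasible TOL N M h kappa /\
    model_work N M h <= K * TOL `^ (- work_exponent a eta gamma eps).
Proof.
(* The first summand of [c1] controls the term in [C1], the second one the
   mixed term in [C2]. Adding 1 in [c2] makes [M^delta >= T^-1], which gives the
   mixed term one of the two factors [T^-1] that it needs. *)
pose c1 : R := (8 * C1 / alpha) `^ beta^-1 + 8 * C2 / alpha.
pose c2 : R := (4 * C3 + 1) `^ delta^-1.
pose c3 : R := (4 * Cdisc)^-1 `^ (- (gamma / eta)).
have C1a_gt0 : 0 < 8 * C1 / alpha by rewrite divr_gt0 // mulr_gt0.
have C2a_ge0 : 0 <= 8 * C2 / alpha by rewrite divr_ge0 ?mulr_ge0 // ltW.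
have c1_gt0 : 0 < c1 by rewrite ltr_wpDr // powR_gt0.
have C3_gt0 : 0 < 4 * C3 + 1 by move: C3_ge0; lra.
have c2_gt0 : 0 < c2 by rewrite powR_gt0.
exists ((c1 + 1) * (c2 + 1) * c3) => T T01; have /andP[T0 T1] := T01.
have Tn0 : T != 0 by rewrite gt_eqF.
have b2 : 1 <= 2 / beta by rewrite ler_pdivlMr //; move: eps_gt0 a_ge0; lra.
have b2_ge0 : 0 <= 2 / beta by apply: le_trans b2.
have d1_ge0 : 0 <= delta^-1 by rewrite invr_ge0 ltW.
have [N N0 /andP[N_ge N_le]] := nat_near_power c1_gt0 T01 b2_ge0.
have [M M0 /andP[M_ge M_le]] := nat_near_power c2_gt0 T01 d1_ge0.
have X0 : 0 < T / (4 * Cdisc) by rewrite divr_gt0 // mulr_gt0.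
exists N, M, ((T / (4 * Cdisc)) `^ eta^-1), 2^-1.
have N_gt0 : 0 < N%:R :> R by rewrite ltr0n.
have NP : 0 < N%:R `^ beta :> R by exact: powR_nat_gt0.
have MP : 0 < M%:R `^ delta :> R by exact: powR_nat_gt0.
have M_pow : (4 * C3 + 1) * T^-1 <= M%:R `^ delta.
  rewrite -powRV_le ?ler0n //; last by rewrite mulr_ge0 ?invr_ge0 ?ltW.
  apply: le_trans M_ge; rewrite powRM ?invr_ge0 ?(ltW T0) ?(ltW C3_gt0) //.
  by rewrite powRVN ?(ltW T0).
have N_pow : 8 * C1 / alpha * T ^- 2 <= N%:R `^ beta.
  rewrite -powRV_le ?ler0n //; last by rewrite mulr_ge0 ?invr_ge0 ?exprn_ge0 ?ltW.
  apply: le_trans N_ge; rewrite powRM ?invr_ge0 ?exprn_ge0 ?(ltW T0) ?(ltW C1a_gt0) //.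
  rewrite -powRN2 // -powRrM mulNr ler_pM2r ?powR_gt0 //.
  by rewrite lerDl.
(* The other factor [T^-1] comes from [N], as [2 / beta >= 1]. *)
have N_lin : 8 * C2 / alpha * T^-1 <= N%:R.
  apply: le_trans N_ge; apply: ler_pM => //; rewrite ?invr_ge0 ?(ltW T0) //.
    by rewrite lerDr powR_ge0.
  by rewrite -(powR_inv1 (ltW T0)) ger_powR ?T01 // lerN2.
split; last first.
  rewrite /rDLQ_work -powRrM /work_exponent !opprD !powRD ?Tn0 ?implybT //.
  rewrite mulrN (mulrC eta^-1) powRM ?invr_ge0 ?(ltW T0) ?mulr_ge0 ?(ltW Cdisc_gt0) //.
  rewrite -/c3 [leRHS](_ : _ = ((c1 + 1) * T `^ (- (2 / beta)))
     * ((c2 + 1) * T `^ (- delta^-1)) * (T `^ (- (gamma / eta)) * c3)); last by ring.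
  by do !(apply: ler_pM => //; rewrite ?mulr_ge0 ?powR_ge0 //).
split; rewrite ?powR_gt0 //.
- by lra.
- rewrite sqr_tolerance.
  have v1 : C1 / N%:R `^ beta <= alpha / 8 * T ^+ 2.
    rewrite ler_pdivrMr //.
    apply: le_trans (ler_wpM2l _ N_pow); last by rewrite mulr_ge0 ?exprn_ge0 ?divr_ge0 ?ltW.
    by rewrite le_eqVlt; apply/orP; left; apply/eqP; field; rewrite Tn0 gt_eqF.
  have v2 : C2 / (N%:R * M%:R `^ delta) <= alpha / 8 * T ^+ 2.
    rewrite ler_pdivrMr ?mulr_gt0 //.
    have TV0 : 0 <= T^-1 by rewrite invr_ge0 ltW.
    have MT : T^-1 <= M%:R `^ delta.
      apply: le_trans M_pow; rewrite ler_peMl ?invr_ge0 ?(ltW T0) //; move: C3_ge0; lra.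
    have NMT : 8 * C2 / alpha * T^-1 * T^-1 <= N%:R * M%:R `^ delta.
      by apply: ler_pM => //; exact: mulr_ge0.
    apply: le_trans (ler_wpM2l _ NMT); last by rewrite mulr_ge0 ?exprn_ge0 ?divr_ge0 ?ltW.
    by rewrite le_eqVlt; apply/orP; left; apply/eqP; field; rewrite Tn0 gt_eqF.
  rewrite /variance_bound exprMn; apply: le_trans (lerD v1 v2) _.
  by rewrite le_eqVlt; apply/orP; left; apply/eqP; field.
- rewrite /bias_bound -powRrM mulVf ?gt_eqF // powRr1 ?(ltW X0) //.
  have b1 : Cdisc * (T / (4 * Cdisc)) = T / 4 by field; rewrite gt_eqF.
  have b3 : C3 / M%:R `^ delta <= T / 4.
    rewrite ler_pdivrMr //.
    apply: le_trans (ler_wpM2l _ M_pow); last by rewrite divr_ge0 ?ltW.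
    rewrite [leRHS](_ : _ = C3 + 4^-1); last by field.
    by rewrite lerDl.
  by rewrite b1; lra.
Qed.

(** The variance constraint bounds [kappa] below by [k1], independently of [h],
    and the bias constraint is loosest at this smallest [kappa]. *)
Lemma feasible_best_step {TOL N M h kappa} : 0 < TOL ->
  feasible TOL N M h kappa ->
  exists h1 kappa1, feasible TOL N M h1 kappa1 /\
    forall h' kappa', feasible TOL N M h' kappa' -> h' <= h1.
Proof.
move=> T0 feas0.
pose V := variance_bound C1 C2 eps a N M.
pose k1 := Num.sqrt (V / alpha) / TOL.
pose slack := (1 - k1) * TOL - C3 / M%:R `^ delta.
have V0 : 0 < V by have [[N0 M0] _ _ _ _] := feas0; exact: variance_bound_gt0.
have k1P h' kappa' : feasible TOL N M h' kappa' ->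
    k1 <= kappa' /\ Cdisc * h' `^ eta <= slack.
  move=> [_ h'0 /andP[k'0 _] + bias]; rewrite sqr_tolerance -/V => var.
  have kk : k1 <= kappa'.
    rewrite ler_pdivrMr // -(ler_sqr (x := Num.sqrt _)) ?nnegrE ?sqrtr_ge0 //; last first.
      by rewrite mulr_ge0 ?ltW.
    rewrite sqr_sqrtr ?divr_ge0 ?(ltW V0) ?(ltW alpha_gt0) //.
    by rewrite ler_pdivrMr // mulrC.
  split=> //; rewrite lerBrDr; apply: le_trans bias _.
  by rewrite ler_pM2r // lerB.
have [kk0 hs0] := k1P _ _ feas0.
have [NM0 h0 /andP[_ kappa_lt1] _ _] := feas0.
have slack0 : 0 < slack.
  by apply: lt_le_trans hs0; rewrite mulr_gt0 // powR_gt0.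
exists ((slack / Cdisc) `^ eta^-1), k1; split.
- split=> //.
  + by rewrite powR_gt0 // divr_gt0.
  + by rewrite divr_gt0 ?sqrtr_gt0 ?divr_gt0 //= (le_lt_trans kk0).
  + rewrite sqr_tolerance -/V divfK ?gt_eqF // sqr_sqrtr ?divr_ge0 ?(ltW V0) ?(ltW alpha_gt0) //.
    by rewrite mulrCA divff ?mulr1 // gt_eqF.
  + rewrite /bias_bound -powRrM mulVf ?gt_eqF // powRr1 ?divr_ge0 ?(ltW slack0) ?(ltW Cdisc_gt0) //.
    by rewrite mulrCA divff ?gt_eqF // mulr1 subrK.
- move=> h' kappa' feas'; have [_ hs] := k1P _ _ feas'.
  have [_ h'0 _ _ _] := feas'.
  have {}hs : h' `^ eta <= slack / Cdisc by rewrite ler_pdivlMr // mulrC.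
  rewrite -[h']powRr1 ?(ltW h'0) // -(mulfV (x := eta)) ?gt_eqF // powRrM.
  by apply: ge0_ler_powR => //; rewrite ?nnegrE ?powR_ge0 // ltW // ?invr_gt0 // divr_gt0.
Qed.

Lemma optimal_exists {TOL} : 0 < TOL -> exists N M h kappa, optimal TOL N M h kappa.
Proof.
move=> T0.
pose Q N M := exists h kappa, feasible TOL N M h kappa.
(* [s] selects a best step and splitting for every feasible pair of sample
   sizes; its value at the other pairs is arbitrary. *)
have /choice[s sP] (p : nat * nat) : exists hk : R * R, Q p.1 p.2 ->
    feasible TOL p.1 p.2 hk.1 hk.2 /\
    forall h' kappa', feasible TOL p.1 p.2 h' kappa' -> h' <= hk.1.
  have [[h [kappa feas]]|nQ] := pselect (Q p.1 p.2); last by exists (0, 0).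
  have [h1 [k1 H]] := feasible_best_step T0 feas.
  by exists (h1, k1).
pose w N M := model_work N M (s (N, M)).1.
pose c := Cdisc `^ (gamma / eta) * TOL `^ (- (gamma / eta)).
have c0 : 0 < c by rewrite mulr_gt0 // powR_gt0.
have Q0 : exists N M, Q N M.
  have [K HK] := feasible_cheap.
  have [|N [M [h [kappa [feas _]]]]] := HK (Num.min TOL 1).
    by rewrite lt_min T0 ltr01 ge_min lexx orbT.
  exists N, M, h, kappa; apply: feasible_mono feas.
  by rewrite lt_min T0 ltr01 ge_min lexx.
have [|N [M [QNM NM_min]]] := coercive_pair_min (w := w) c0 Q0.
  move=> N M QNM; have [feas _] := sP (N, M) QNM.
  have [[N0 M0] _ _ _ _] := feas; split=> //.
  rewrite mulrC /w /rDLQ_work ler_wpM2l ?mulr_ge0 //.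
  exact: step_work_ge T0 feas.
have [feas _] := sP (N, M) QNM.
exists N, M, (s (N, M)).1, (s (N, M)).2; split=> // N' M' h' kappa' feas'.
have QNM' : Q N' M' by exists h', kappa'.
apply: le_trans (NM_min _ _ QNM') _.
have [[_ sh0 _ _ _] /(_ _ _ feas') h's] := sP (N', M') QNM'.
have [_ h'0 _ _ _] := feas'.
rewrite /w /rDLQ_work ler_wpM2l ?mulr_ge0 // !powRN lef_pV2 ?posrE ?powR_gt0 //.
by apply: ge0_ler_powR => //; rewrite ?nnegrE ltW.
Qed.

(** Small tolerances force small steps, so that an asymptotic cost bound as
    [h] tends to 0 applies to the optimal step. *)
Lemma feasible_step_small {TOL N M h kappa r} : 0 < TOL -> 0 < r ->
  TOL < Cdisc * r `^ eta -> feasible TOL N M h kappa -> h < r.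
Proof.
move=> T0 r0 Tr feas; have [_ h0 _ _ _] := feas.
have [_ _] := feasible_bounds T0 feas.
rewrite powR_inv1 ?(ltW T0) // ler_pdivrMr // powRVN ?(ltW h0) // powRN.
rewrite mulrC ler_pdivlMr ?powR_gt0 // => hT.
rewrite ltNge; apply/negP => rh.
have : r `^ eta <= h `^ eta.
  by apply: ge0_ler_powR => //; rewrite ?nnegrE ltW.
rewrite -(ler_pM2l Cdisc_gt0) => H.
by have := lt_le_trans Tr (le_trans H hT); rewrite ltxx.
Qed.

Lemma optimal_work_bigO {cost : R -> R} :
  (forall h, 0 <= cost h) ->
  (exists Cw, \forall h \near 0^'+, cost h <= Cw * h `^ (- gamma)) ->
  exists K, \forall TOL \near 0^'+, forall N M h kappa,
    optimal TOL N M h kappa ->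
    rDLQ_work cost N M h <= K * TOL `^ (- work_exponent a eta gamma eps).
Proof.
move=> cost_ge0 [Cw [r /= r0 cost_le]].
have [K HK] := feasible_cheap.
(* The hypothesis does not fix the sign of [Cw]. *)
exists (`|Cw| * K); near=> T => N M h kappa [feas h_min].
have T0 : 0 < T by near: T; exact: nbhs_right_gt.
have T1 : T <= 1 by near: T; exact: nbhs_right_le.
have Tr : T < Cdisc * r `^ eta.
  by near: T; apply: nbhs_right_lt; rewrite mulr_gt0 // powR_gt0.
have [_ h0 _ _ _] := feas.
have hr := feasible_step_small T0 r0 Tr feas.
have cost_h : cost h <= `|Cw| * h `^ (- gamma).
  apply: le_trans (ler_wpM2r (powR_ge0 _ _) (ler_norm Cw)).
  by apply: cost_le => //=; rewrite sub0r normrN gtr0_norm.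
have [|N' [M' [h' [kappa' [feas' work']]]]] := HK T; first by rewrite T0.
have opt_le := le_trans (h_min _ _ _ _ feas') work'.
rewrite -mulrA; apply: le_trans (ler_wpM2l (normr_ge0 Cw) opt_le).
by rewrite /rDLQ_work mulrCA ler_wpM2l ?mulr_ge0.
Unshelve. all: by end_near. Qed.

Lemma bigO_constant_ge {K} :
  (\forall TOL \near 0^'+, forall N M h kappa, optimal TOL N M h kappa ->
    model_work N M h <= K * TOL `^ (- work_exponent a eta gamma eps)) ->
  (C1 / alpha) `^ beta^-1 * C3 `^ delta^-1 * Cdisc `^ (gamma / eta) <= K.
Proof.
move=> HK.
have [T [T0 {}HK]] := filter_ex (filterI (nbhs_right_gt 0) HK).
have [N [M [h [kappa opt]]]] := optimal_exists T0.
have [feas _] := opt.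
have := le_trans (feasible_work_ge T0 feas) (HK _ _ _ _ opt).
by rewrite ler_pM2r // powR_gt0.
Qed.

End sample_allocation.

(** * Blow-up of the implied constant and conclusion *)

(** A lower bound uniform in the exponents, which vary with [eps]: only
    [2^-1 <= r] and [0 <= s] are known of them. *)
Lemma le_powR_mul_of_sqr_le (R : realType) (B x y r s : R) :
  0 <= B -> B ^+ 2 <= x -> 1 <= x -> 1 <= y -> 2^-1 <= r -> 0 <= s ->
  B <= x `^ r * y `^ s.
Proof.
move=> B0 Bx x1 y1 r2 s0.
have x0 : 0 <= x by apply: le_trans x1.
rewrite -[B]mulr1; apply: ler_pM => //; last by rewrite -(powRr0 y) ler_powR.
apply: (@le_trans _ _ (x `^ 2^-1)); last by rewrite ler_powR.
by rewrite powR12_sqrt // -(ger0_norm B0) -sqrtr_sqr ler_wsqrtr.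
Qed.

Lemma Amax_ge0 {R : realType} {d} (A : 'I_d -> R) : 0 <= Amax A.
Proof. exact: bigmax_ge_id. Qed.

(** The bounds on the moments are only assumed for small [h], and some such [h]
    is enough to see that they are nonnegative. *)
Lemma cube_inte_bound_ge0 (R : realType) d (F : R -> 'rV[R]_d -> R) (m : R) :
  (forall h z, 0 <= F h z) ->
  (\forall h \near 0^'+, (cube_inte (fun z => (F h z)%:E) <= m%:E)%E) -> 0 <= m.
Proof.
move=> F0 Fm; have [h [_ Fh]] := filter_ex (filterI (nbhs_right_gt 0) Fm).
rewrite -lee_fin; apply: le_trans Fh; apply: integral_ge0 => t _.
by rewrite lee_fin.
Qed.

Theorem proposition5 (R : realType) (d1 d2 : nat)
  (d1_gt0 : (0 < d1)%N) (d2_gt0 : (0 < d2)%N)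
  (f : R -> R) (g : 'rV[R]_d1 -> 'rV[R]_d2 -> R)
  (gh : R -> 'rV[R]_d1 -> 'rV[R]_d2 -> R) (cost : R -> R)
  (* randomized low-discrepancy sequences *)
  (dO : measure_display) (Omega : measurableType dO) (P : probability Omega R)
  (Gu : 'I_d1 -> nat -> nat -> bool) (Gt : 'I_d2 -> nat -> nat -> bool)
  (rho : 'I_d1 -> seq bool -> Omega -> {perm bool})
  (rhos : nat -> 'I_d2 -> seq bool -> Omega -> {perm bool})
  (Gu_low : low_discrepancy (fun n => bits_point R (digital_sequence Gu n)))
  (Gt_low : low_discrepancy (fun n => bits_point R (digital_sequence Gt n)))
  (rhoP : owen_scramblings P rho rhos)
  (* the integrands *)
  (f_nonlinear : nonlinear f)
  (f_derivable : forall n (x : R), (n < 3)%N -> derivable (derive1n n f) x 1)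
  (f2_monotonic : monotonic (fun x => `|derive1n 2 f x|))
  (f3_monotonic : monotonic (fun x => `|derive1n 3 f x|))
  (g_integrable : {ae cube_prob R d1, forall t, cube_integrable (g (vec t))})
  (I_integrable : cube_integrable (fun y => f (gbar g y)))
  (gh_integrable : forall (h : R) (y : 'rV[R]_d1), 0 < h -> cube y ->
    cube_integrable (gh h y))
  (* condition 1 *)
  (b : R) (A : 'I_d1 -> R) (b_gt0 : 0 < b)
  (A_gt0 : forall i, 0 < A i) (A_lt : Amax A < 2^-1)
  (boundary_growth : forall h : R, 0 < h ->
    exists2 D, mixed_partials (@open_cube R d1) (fun y => f (gbar (gh h) y)) D &
      forall (u : {set 'I_d1}) z, open_cube z ->
        `|D u z| <=
        b * \prod_i (Num.min (z 0 i) (1 - z 0 i)) `^ (- A i - (i \in u)%:R))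
  (* condition 2 *)
  (Cdisc eta gamma : R)
  (Cdisc_gt0 : 0 < Cdisc) (eta_gt0 : 0 < eta) (gamma_gt0 : 0 < gamma)
  (bias_disc : forall h : R, 0 < h ->
    `|cube_int (fun y => f (gbar (gh h) y)) - nested_integral f g|
    <= Cdisc * h `^ eta)
  (cost_ge0 : forall h, 0 <= cost h)
  (cost_bigO : exists Cw, \forall h \near 0^'+, cost h <= Cw * h `^ (- gamma))
  (* condition 3 *)
  (deltaK : R) (p : \bar R) (deltaK_01 : 0 < deltaK < 1) (p_ge1 : (1 <= p)%E)
  (f_gbar_W3 : forall h K : R, 0 < h -> 1 - deltaK < K < 1 + deltaK ->
    sobolev 3 p (fun y => f (K * gbar (gh h) y)))
  (* condition 4 *)
  (k : R) (k_ge0 : 0 <= k)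
  (gh_VHK : \forall h \near 0^'+,
    (forall y, cube y -> mixed_C1 (gh h y) /\ gbar (gh h) y != 0) /\
    (ereal_sup [set `|VHK (gh h y) * ((gbar (gh h) y)^-1)%:E| | y in @cube R d1]
       <= k%:E)%E)
  (q : \bar R) (q_ge1 : (1 <= q)%E) (pq : (p^-1 + q^-1 = 1)%E)
  (gbar_L3q : \forall h \near 0^'+, cube_Lp (3%:E * q)%E (gbar (gh h)))
  (* condition 5 *)
  (deltaK' : R) (p' : \bar R)
  (deltaK'_01 : 0 < deltaK' < 1) (p'_ge1 : (1 <= p')%E)
  (f_gbar_W2 : \forall h \near 0^'+, forall K, 1 - deltaK' < K < 1 + deltaK' ->
    sobolev 2 (2%:E * p')%E (fun y => f (K * gbar (gh h) y)))
  (* condition 6; its bound on the variation is [gh_VHK] *)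
  (q' : \bar R) (q'_ge1 : (1 <= q')%E) (pq' : (p'^-1 + q'^-1 = 1)%E)
  (gbar_L4q' : \forall h \near 0^'+, cube_Lp (4%:E * q')%E (gbar (gh h)))
  (* moments staying finite as h tends to 0 *)
  (m2 m3 : R)
  (m2P : \forall h \near 0^'+,
    (cube_inte (fun y => (`|gbar (gh h) y| ^+ 2 *
                          `|derive1 f (gbar (gh h) y)| ^+ 2)%:E) <= m2%:E)%E)
  (m3P : \forall h \near 0^'+,
    (cube_inte (fun y => (`|gbar (gh h) y| ^+ 2 *
                          `|derive1n 2 f (gbar (gh h) y)|)%:E) <= m3%:E)%E)
  (* discrepancy constants and root mean square error constant *)
  (Ceps : R -> nat -> R) (BA : R)
  (Ceps_gt0 : forall (eps : R) d, 0 < eps -> 0 < Ceps eps d) (BA_gt0 : 0 < BA)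
  (Ceps_d1 : forall eps : R, 0 < eps -> {ae P, forall w, forall N, (0 < N)%N ->
    star_discrepancy (scrambled_point R rho Gu w) N
    <= Ceps eps d1 * N%:R `^ (- 1 + eps)})
  (Ceps_d2 : forall (eps : R) n, 0 < eps -> {ae P, forall w, forall M, (0 < M)%N ->
    star_discrepancy (scrambled_point R (rhos n) Gt w) M
    <= Ceps eps d2 * M%:R `^ (- 1 + eps)})
  (BA_rmse : forall (eps h : R) N, 0 < eps -> 0 < h -> (0 < N)%N ->
    ('N[P]_(2%:E)[(fun w =>
      (N%:R^-1 * \sum_(n < N) f (gbar (gh h) (scrambled_point R rho Gu w n))
       - cube_int (fun y => f (gbar (gh h) y)))%:E)]
     <= (b * BA * Ceps eps d1 * N%:R `^ (- 1 + eps + Amax A))%:E)%E)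
  (* confidence level *)
  (alpha : R) (alpha_01 : 0 < alpha < 1) :
  let C1 := fun eps => CQ1 b BA (Ceps eps d1) in
  let C2 := fun eps => CQ2 m2 k (Ceps eps d2) in
  let C3 := fun eps => CQ3 m3 k (Ceps eps d2) in
  let optimized := fun (c : R -> R) eps TOL =>
    optimized_rDLQ
      (rDLQ_optimal (C1 eps) (C2 eps) (C3 eps) Cdisc eta gamma alpha (Amax A)
         eps TOL)
      f gh Gu Gt rho rhos c in
  [/\ (* the optimized estimator exists *)
      forall eps TOL : R, 0 < eps < 1 - Amax A -> 0 < TOL ->
        exists Ihat W, optimized cost eps TOL Ihat W,
      (* its work has the stated order *)
      forall eps : R, 0 < eps < 1 - Amax A ->
        exists K, \forall TOL \near 0^'+,
          forall Ihat W, optimized cost eps TOL Ihat W ->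
            W <= K * TOL `^ (- work_exponent (Amax A) eta gamma eps) &
      (* implied constants for the minimal value of N M h^-gamma blow up *)
      C1 eps @[eps --> 0^'+] --> +oo ->
      C2 eps @[eps --> 0^'+] --> +oo ->
      C3 eps @[eps --> 0^'+] --> +oo ->
      forall K : R -> R,
        (forall eps : R, 0 < eps < 1 - Amax A -> \forall TOL \near 0^'+,
          forall Ihat W, optimized (fun h => h `^ (- gamma)) eps TOL Ihat W ->
            W <= K eps * TOL `^ (- work_exponent (Amax A) eta gamma eps)) ->
        K eps @[eps --> 0^'+] --> +oo].
Proof.
move=> C1 C2 C3 optimized.
have alpha_gt0 : 0 < alpha by case/andP: alpha_01.
have a_ge0 : 0 <= Amax A := Amax_ge0 A.
have m2_ge0 : 0 <= m2.
  by apply: cube_inte_bound_ge0 m2P => h y; rewrite mulr_ge0 // exprn_ge0.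
have m3_ge0 : 0 <= m3.
  by apply: cube_inte_bound_ge0 m3P => h y; rewrite mulr_ge0 // exprn_ge0.
have C1_gt0 eps : 0 < eps -> 0 < C1 eps.
  by move=> eps0; rewrite /C1 /CQ1 !mulr_gt0 ?exprn_gt0 ?Ceps_gt0.
have C2_ge0 eps : 0 < eps -> 0 <= C2 eps.
  by move=> /Ceps_gt0 /ltW Ceps_ge0; rewrite /C2 /CQ2 !mulr_ge0 ?exprn_ge0.
have C3_ge0 eps : 0 < eps -> 0 <= C3 eps.
  by move=> /Ceps_gt0 /ltW Ceps_ge0; rewrite /C3 /CQ3 !mulr_ge0 ?exprn_ge0.
split.
- move=> eps TOL /andP[eps0 eps1] T0.
  have [N [M [h [kappa opt]]]] := optimal_exists (C1_gt0 _ eps0) (C2_ge0 _ eps0)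
    (C3_ge0 _ eps0) Cdisc_gt0 eta_gt0 gamma_gt0 alpha_gt0 a_ge0 eps0 eps1 T0.
  exists (rDLQ f gh Gu Gt rho rhos N M h), (rDLQ_work cost N M h).
  by exists N, M, h, kappa.
- move=> eps /andP[eps0 eps1].
  have [K HK] := optimal_work_bigO (C1_gt0 _ eps0) (C2_ge0 _ eps0)
    (C3_ge0 _ eps0) Cdisc_gt0 eta_gt0 alpha_gt0 a_ge0 eps0 eps1
    cost_ge0 cost_bigO.
  exists K; apply: filterS HK => TOL HK Ihat W [N [M [h [kappa [opt _ ->]]]]].
  exact: HK opt.
- move=> C1_oo _ C3_oo K HK; apply/cvgryPge => B.
  pose D := Cdisc `^ (gamma / eta).
  have D0 : 0 < D by rewrite powR_gt0.
  have a1 : 0 < 1 - Amax A by move: A_lt; lra.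
  near=> eps.
  have eps0 : 0 < eps by near: eps; exact: nbhs_right_gt.
  have eps1 : eps < 1 - Amax A by near: eps; exact: nbhs_right_lt.
  have C1_large : alpha * Num.max 1 ((`|B| / D) ^+ 2) <= C1 eps.
    by near: eps; move/cvgryPge: C1_oo; apply.
  have C3_large : 1 <= C3 eps by near: eps; move/cvgryPge: C3_oo; apply.
  have const_le : (C1 eps / alpha) `^ (2 - 2 * eps - 2 * Amax A)^-1
      * C3 eps `^ (2 - 2 * eps)^-1 * D <= K eps.
    apply: (bigO_constant_ge (C1_gt0 _ eps0) (C2_ge0 _ eps0) (C3_ge0 _ eps0)
      Cdisc_gt0 eta_gt0 gamma_gt0 alpha_gt0 a_ge0 eps0 eps1).
    have eps01 : 0 < eps < 1 - Amax A by rewrite eps0.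
    apply: filterS (HK _ eps01) => TOL HKT N M h kappa opt.
    by apply: (HKT (rDLQ f gh Gu Gt rho rhos N M h)); exists N, M, h, kappa.
  apply: le_trans const_le; apply: le_trans (ler_norm B) _.
  have C1a : Num.max 1 ((`|B| / D) ^+ 2) <= C1 eps / alpha.
    by rewrite ler_pdivlMr // mulrC.
  move: C1a; rewrite ge_max => /andP[x1 xB]; rewrite -ler_pdivrMr //.
  apply: le_powR_mul_of_sqr_le => //.
  + by rewrite divr_ge0 // ltW.
  + by rewrite lef_pV2 ?posrE //; move: eps0 eps1 a_ge0; lra.
  + by rewrite invr_ge0; move: eps1 a_ge0; lra.
Unshelve. all: by end_near. Qed.
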